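(* Let $G$ be a connected bipartite graph and let $T$ be a spanning tree of $G$. Let $\mu_G(x)$ be the matching polynomial of $G$. Then there exists a partial orientation $\sigma$ of $G$ with respect to $T$ such that $\rho(G_T^\sigma) \le \rho(\mu_G)$.
   Context: Graphs are finite and simple. Let $G=(V,E)$ be a connected graph with spanning tree $T$. A partial orientation $\sigma$ of $G$ with respect to $T$ is an orientation of the edges in $E(G)\setminus E(T)$, the edges of $T$ being left undirected. Formally, to each ordered pair $(u,v)$ of vertices with $\{u,v\}\notin E(T)$ it assigns $\sigma(u,v)\in\{0,1,-1\}$ with $\sigma(u,v)=-\sigma(v,u)$ and $\sigma(u,v)\neq 0$ if and only if $\{u,v\}\in E(G)$; the edge $\{u,v\}\in E(G)\setminus E(T)$ is oriented from $u$ to $v$ if $\sigma(u,v)=1$ and from $v$ to $u$ if $\sigma(u,v)=-1$. The resulting mixed graph is denoted $G_T^\sigma$. Its Hermitian adjacency matrix is $H(G_T^\sigma)=(h_{uv})_{u,v\in V}$, where $h_{uv}=1$ if $\{u,v\}\in E(T)$, $h_{uv}=\mathbf{i}\,\sigma(u,v)$ if $\{u,v\}\in E(G)\setminus E(T)$, and $h_{uv}=0$ otherwise, with $\mathbf{i}=\sqrt{-1}$. The spectral radius $\rho(G_T^\sigma)$ is the largest modulus of the eigenvalues of $H(G_T^\sigma)$. For a graph $G$ of order $n$, the matching polynomial is $\mu_G(x)=\sum_{k\ge 0}(-1)^k m_k(G)x^{n-2k}$, where $m_k(G)$ is the number of matchings (sets of pairwise non-adjacent edges) of $G$ with exactly $k$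 edges and $m_0(G)=1$. $\rho(\mu_G)$ denotes the largest absolute value of the roots of $\mu_G(x)$. *)

(* Defs.v *)
From HB Require Import structures.
From mathcomp Require Import all_boot all_order all_algebra.
From mathcomp Require Import complex.
From mathcomp Require Import boolp classical_sets reals.

Set Implicit Arguments.
Unset Strict Implicit.
Unset Printing Implicit Defensive.

Import Order.TTheory GRing.Theory Num.Theory.

Local Open Scope ring_scope.
Local Open Scope complex_scope.

Record sgraph (V : finType) := SGraph {
  adj :> rel V;
  adj_sym : symmetric adj;
  adj_irr : irreflexive adj }.

Section Graphs.
Variables (V : finType) (G : sgraph V).

Definition connected : Prop :=
  (0 < #|V|)%N /\ forall x y : V, connect G x y.

Definition bipartite : Prop :=
  exists A : {set V}, forall x y : V, G x y -> (x \in A) != (y \in A).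

(* A closed walk x, y, x is a simple cycle of size 2 for [ucycle],
   hence the length bound. *)
Definition acyclic : Prop :=
  forall c : seq V, (2 < size c)%N -> ~ ucycle G c.

Definition edges : {set {set V}} :=
  [set [set p.1; p.2] | p : V * V & G p.1 p.2]%SET.

(* Two distinct edges are non-adjacent iff they are disjoint. *)
Definition matchings (k : nat) : {set {set {set V}}} :=
  [set M : {set {set V}} |
    [&& M \subset edges, finset.trivIset M & #|M| == k]]%SET.

(* A matching has at most #|V|./2 edges, so that the exponents below do not
   underflow and no nonzero term of the sum over all k is omitted. *)
Definition matching_poly (R : nzRingType) : {poly R} :=
  \sum_(k < (#|V|./2).+1)
     ((-1) ^+ k * #|matchings k|%:R) *: 'X^(#|V| - k.*2).

End Graphs.

Definition spanning_tree (V : finType) (G T : sgraph V) : Prop :=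
  [/\ subrel T G, connected T & acyclic T].

(* sigma is only meaningful on pairs that are not edges of T; its values on
   the edges of T are arbitrary and are never used. *)
Definition partial_orientation (V : finType) (G T : sgraph V)
    (sigma : V -> V -> int) : Prop :=
  forall u v : V, ~~ T u v ->
    [/\ sigma u v \in [:: 0; 1; -1],
        sigma u v = - sigma v u
      & (sigma u v != 0) = G u v].

Definition hermitian_adj (R : realType) (V : finType) (G T : sgraph V)
    (sigma : V -> V -> int) : 'M[R[i]]_#|V| :=
  \matrix_(i, j)
    let u := enum_val i in let v := enum_val j in
    if T u v then 1
    else if G u v then 'i * (sigma u v)%:~R
    else 0.

Definition max_modulus (R : realType) (P : pred R[i]) : R :=
  sup [set ComplexField.Normc.normc z | z in [set z | P z]]%classic.

Definition spectral_radius (R : realType) (n : nat) (A : 'M[R[i]]_n) : R :=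
  max_modulus (eigenvalue A).

Definition root_radius (R : realType) (p : {poly R[i]}) : R :=
  max_modulus (root p).

(* The suprema above are maxima. *)
Lemma root_radiusP (R : realType) (p : {poly R[i]}) : (1 < size p)%N ->
  (exists2 z, root p z & root_radius p = ComplexField.Normc.normc z) /\
  (forall z, root p z -> ComplexField.Normc.normc z <= root_radius p).
Proof.
move=> sp; have [s Ep] := closed_field_poly_normal p.
have p0 : p != 0 by rewrite -size_poly_gt0 ltnW.
have rootE z : root p z = (z \in s).
  by rewrite Ep rootZ ?lead_coef_eq0 // root_prod_XsubC.
have [z0 z0r] : exists z, root p z by apply/closed_rootP; rewrite gtn_eqF.
have [zm zmr zmP] : exists2 z, root p z & forall y, root p y ->
    ComplexField.Normc.normc y <= ComplexField.Normc.normc z.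
  have z0s : z0 \in s by rewrite -rootE.
  case: (@arg_maxP _ _ (seq_sub s) (SeqSub z0s) xpredT
           (fun y => ComplexField.Normc.normc (ssval y))) => // i _ iP.
  exists (ssval i); first by rewrite rootE (valP i).
  by move=> y; rewrite rootE => ys; exact: (iP (SeqSub ys)).
have supE : root_radius p = ComplexField.Normc.normc zm.
  apply/eqP; rewrite eq_le; apply/andP; split.
    apply: ge_sup; first by exists (ComplexField.Normc.normc zm), zm.
    by move=> _ [y yr <-]; exact: zmP.
  apply: ub_le_sup; last by exists zm.
  by exists (ComplexField.Normc.normc zm) => _ [y yr <-]; exact: zmP.
by split; [exists zm | move=> z; rewrite supE; exact: zmP].
Qed.

Lemma spectral_radiusE (R : realType) (n : nat) (A : 'M[R[i]]_n) :
  spectral_radius A = root_radius (char_poly A).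
Proof.
rewrite /spectral_radius /root_radius; congr max_modulus.
by apply/funext => a; rewrite eigenvalue_root_char.
Qed.

(* Main.v *)
(* The matching polynomial of G is the average, over all orientations of the
   edges outside T, of the characteristic polynomial of the Hermitian adjacency
   matrix: in the Leibniz expansion a permutation with a cycle of length at
   least 3 uses some chord of T exactly once, so reversing that chord cancels it.
   Some orientation has its largest eigenvalue at most that of the average
   because the partial averages form an interlacing family, as in the work of
   Marcus, Spielman and Srivastava.  Fix the chords one at a time.  Up to a
   common diagonal shift, the two choices for a chord are rank-one updates
   [g - h1], [g - h2] of one partial average [g]; real stability of the averages
   (non-vanishing on matrices with positive definite imaginary part) makes
   [h1 / g] and [h2 / g] nonincreasing above the roots of [g], so one of the two
   choices has no root above the largest root of their sum.  Finally, G being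
   bipartite, the spectrum is symmetric and the largest eigenvalue is the
   spectral radius. *)
Require Import Defs.
From mathcomp Require Import all_boot all_order all_fingroup all_algebra.
From mathcomp Require Import polyrcf complex.
From mathcomp Require Import boolp reals.
From mathcomp Require functions topology normedtype derive.
From mathcomp Require Import ring lra zify.

Set Implicit Arguments.
Unset Strict Implicit.
Unset Printing Implicit Defensive.

Import Order.TTheory GRing.Theory Num.Theory.

Local Open Scope ring_scope.
Local Open Scope complex_scope.

(** * Positivity of real polynomials above a threshold, and interlacing *)

Section RealPolynomials.
Import classical_sets functions topology normedtype derive.
Import numFieldNormedType.Exports.
Variable R : realType.
Implicit Types (p g h : {poly R}) (x y t : R).

(** For a positive leading coefficient: no real root lies strictly above [t]. *)
Definition pos_above t p := forall x, t < x -> 0 < p.[x].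

Lemma horner_ge0_right y p : (forall x, y < x -> 0 <= p.[x]) -> 0 <= p.[y].
Proof.
move=> p_ge0; rewrite leNgt; apply/negP => py_lt0.
have [|d d_gt0 near_y] := @poly_cont _ y p (- p.[y]); first by rewrite oppr_gt0.
have := near_y (y + d / 2).
rewrite addrAC subrr add0r gtr0_norm ?divr_gt0 // ltr_pdivrMr //.
rewrite ltr_pMr // ltr1n => /(_ isT).
have := p_ge0 (y + d / 2); rewrite ltrDl divr_gt0 // => /(_ isT) pyd.
rewrite ger0_norm ?subr_ge0 ?(le_trans (ltW py_lt0)) //.
by rewrite ltrBlDr addNr ltNge pyd.
Qed.

(** The witness is the largest real root of [p]: since [p] is positive near infinity, the
    intermediate value theorem puts a root at or above any point where [p] is nonpositive. *)
Lemma pos_above_root p x : 0 < lead_coef p -> p.[x] <= 0 ->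
  exists y, [/\ x <= y, p.[y] = 0 & pos_above y p].
Proof.
move=> lcp px; have p0 : p != 0 by rewrite -lead_coef_eq0 gt_eqF.
have [n n_ge] := poly_pinfty_gt_lc lcp.
have rsP z : (z \in rootsR p) = root p z.
  by have := roots_on_rootsR p0 z; rewrite inE.
have root_above z : p.[z] <= 0 -> exists2 w, z <= w & root p w.
  move=> pz; have [||w w_in rw] := @polyrcf.poly_ivt _ p z (Num.max z n).
  - by rewrite le_max lexx.
  - rewrite mulr_le0_ge0 //; apply: le_trans (ltW lcp) (n_ge _ _).
    by rewrite le_max lexx orbT.
  by exists w => //; rewrite (itvP w_in).
have [w0 xw0 rw0] := root_above x px.
have w0s : w0 \in rootsR p by rewrite rsP.
case: (@arg_maxP _ _ (seq_sub (rootsR p)) (SeqSub w0s) xpredT val) => // i _ iP.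
exists (val i); split.
- exact: le_trans xw0 (iP (SeqSub w0s) isT).
- by apply/rootP; rewrite -rsP (valP i).
- move=> z iz; rewrite ltNge; apply/negP => /root_above[w zw rw].
  have ws : w \in rootsR p by rewrite rsP.
  have wi : w <= val i := iP (SeqSub ws) isT.
  by have := lt_le_trans iz (le_trans zw wi); rewrite ltxx.
Qed.

Section Interlacing.
Variables g h : {poly R}.
Hypothesis wronskian_le0 :
  forall x, h^`().[x] * g.[x] - h.[x] * g^`().[x] <= 0.

(** The derivative of [h / g] is the Wronskian divided by [g ^+ 2], and [g] has no zero above
    [t]. *)
Lemma ratio_nonincreasing t x y : pos_above t g -> t < x -> x <= y ->
  h.[y] / g.[y] <= h.[x] / g.[x].
Proof.
move=> g_gt0 tx xy.
have g_n0 z : x <= z -> g.[z] != 0.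
  by move=> xz; rewrite gt_eqF // g_gt0 // (lt_le_trans tx).
pose f : R -> R := fun z => h.[z] / g.[z].
have df z : x <= z ->
    is_derive z (1 : R) f ((h^`().[z] * g.[z] - h.[z] * g^`().[z]) / g.[z] ^+ 2).
  move=> xz; have gz0 := g_n0 _ xz.
  have dV : is_derive z (1 : R) (fun w => g.[w]^-1)
      (- g.[z] ^- 2 *: g^`().[z]).
    have dg : derivable (horner g) z 1 by exact: derivable_horner.
    apply: DeriveDef; first exact: derivableV.
    by rewrite deriveV // derive_val.
  have -> : f = (horner h : R -> R) * (fun w => g.[w]^-1) by [].
  apply: is_derive_eq; rewrite /GRing.scale /=.
  by field.
apply: (@ler0_derive1_nincr R f x y) => //.
- by move=> z; rewrite in_itv /= => /andP[/ltW/df[]].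
- move=> z; rewrite in_itv /= => /andP[xz _]; have [_] := df _ (ltW xz).
  rewrite derive1E => ->; move: xz.
  by move=> xz; rewrite pmulr_lle0 // invr_gt0 exprn_even_gt0 //= g_n0 // ltW.
- apply: derivable_within_continuous => z; rewrite in_itv /= => /andP[].
  by move=> /df[].
Qed.

Hypothesis lead_coef_gt0 : 0 < lead_coef g.
Hypothesis size_lt : (size h < size g)%N.

(* [h / g] is nonincreasing and tends to [0] at infinity. *)
Lemma interlacing_ge0 t x : pos_above t g -> t < x -> 0 <= h.[x].
Proof.
move=> g_gt0 tx; rewrite leNgt; apply/negP => hx.
have gx := g_gt0 _ tx.
(* If [h] were negative at [x], monotonicity would keep [h + e *: g] nonpositive to the right of
   [x]; but its leading coefficient is [e] times that of [g], hence positive. *)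
pose e := - (h.[x] / g.[x]).
have e_gt0 : 0 < e by rewrite oppr_gt0 pmulr_llt0 // invr_gt0.
have [|n n_ge] := @poly_pinfty_gt_lc _ (h + e *: g).
  by rewrite lead_coefDr ?size_scale ?gt_eqF // lead_coefZ mulr_gt0.
pose y := Num.max x n.
have xy : x <= y by rewrite le_max lexx.
have := n_ge y; rewrite {1}/y le_max lexx orbT => /(_ isT).
rewrite lead_coefDr ?size_scale ?gt_eqF // lead_coefZ hornerD hornerZ.
move=> /(lt_le_trans (mulr_gt0 e_gt0 lead_coef_gt0)).
have gy : 0 < g.[y] by apply: g_gt0; apply: lt_le_trans xy.
have := ratio_nonincreasing g_gt0 tx xy.
rewrite ler_pdivrMr // (_ : h.[x] / g.[x] = - e) ?opprK // mulNr.
by rewrite -subr_ge0; lra.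
Qed.

End Interlacing.

(** If [g - h1] or [g - h2] is nonpositive at a point above [t], monotonicity of the ratio keeps it
    nonpositive from there down to [t]. If both claims failed, both differences would be nonpositive
    at a common point, against the positivity of their sum. *)
Lemma pos_above_half g h1 h2 t :
    (forall x, h1^`().[x] * g.[x] - h1.[x] * g^`().[x] <= 0) ->
    (forall x, h2^`().[x] * g.[x] - h2.[x] * g^`().[x] <= 0) ->
    0 < lead_coef g -> (size h1 < size g)%N -> (size h2 < size g)%N ->
    pos_above t ((g - h1) + (g - h2)) ->
  pos_above t (g - h1) \/ pos_above t (g - h2).
Proof.
move=> W1 W2 lcg s1 s2 f_gt0.
(* Otherwise the largest root of [g] lies above [t]; there [h1] and [h2] are nonnegative, which
   makes the sum nonpositive. *)
have g_gt0 : pos_above t g.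
  move=> x tx; rewrite ltNge; apply/negP => gx.
  have [y [xy gy g_gt0]] := pos_above_root lcg gx.
  have h1y : 0 <= h1.[y].
    by apply: horner_ge0_right => z; apply: interlacing_ge0 g_gt0.
  have h2y : 0 <= h2.[y].
    by apply: horner_ge0_right => z; apply: interlacing_ge0 g_gt0.
  by have := f_gt0 y (lt_le_trans tx xy); rewrite !(hornerD, hornerN) gy; lra.
have le0_left h : (forall x, h^`().[x] * g.[x] - h.[x] * g^`().[x] <= 0) ->
    forall x y, t < x -> x <= y -> (g - h).[y] <= 0 -> (g - h).[x] <= 0.
  move=> W x y tx xy; rewrite !hornerE !subr_le0.
  have := ratio_nonincreasing W g_gt0 tx xy.
  have gx := g_gt0 _ tx; have gy := g_gt0 _ (lt_le_trans tx xy).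
  have ratio_ge1 z : 0 < g.[z] -> (g.[z] <= h.[z]) = (1 <= h.[z] / g.[z]).
    by move=> gz; rewrite ler_pdivlMr // mul1r.
  by rewrite !ratio_ge1 // => hyx /le_trans; apply.
apply: contrapT => /not_orP[/existsNP[x1 /not_implyP[tx1 /negP]]].
rewrite -leNgt => f1 /existsNP[x2 /not_implyP[tx2 /negP]].
rewrite -leNgt => f2; pose x := Num.min x1 x2.
have tx : t < x by rewrite lt_min tx1.
have x_le1 : x <= x1 by rewrite ge_min lexx.
have x_le2 : x <= x2 by rewrite ge_min lexx orbT.
have := f_gt0 _ tx; rewrite hornerD.
have := le0_left _ W1 _ _ tx x_le1 f1; have := le0_left _ W2 _ _ tx x_le2 f2.
by lra.
Qed.

End RealPolynomials.

(** * From nonvanishing on the upper half-plane to the sign of the Wronskian *)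

Section Stability.
Variable R : realType.
Local Notation C := R[i].
Local Notation toC := (map_poly (real_complex R)).
Implicit Types (p g h : {poly R}) (x t : R).

(** With [p = q * 'X], the derivative at [0] is [q.[0]], a limit from the right of nonpositive
    values. *)
Lemma deriv0_le0 p : p.[0] = 0 -> (forall t, 0 < t -> p.[t] <= 0) ->
  p^`().[0] <= 0.
Proof.
elim/poly_ind: p => [|q c _]; first by rewrite deriv0 horner0.
rewrite hornerMXaddC mulr0 add0r => -> q_le0; rewrite derivD derivM derivX derivC.
rewrite !hornerE ?mulr0 ?add0r -oppr_ge0 -hornerN; apply: horner_ge0_right => t t0.
rewrite hornerN oppr_ge0; have := q_le0 t t0.
by rewrite hornerMXaddC addr0 pmulr_lle0.
Qed.

(** [u] and [v] are the real and imaginary parts of [p] on the vertical line through [x]; the last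
    equation is a Cauchy-Riemann equation at [t = 0]. *)
Lemma horner_vertical_line p x : exists u v : {poly R},
  [/\ forall t, (toC p).[x +i* t] = u.[t] +i* v.[t],
      u.[0] = p.[x], v.[0] = 0 & v^`().[0] = p^`().[x]].
Proof.
elim/poly_ind: p => [|q c [u [v [uvE u0 v0 dv0]]]].
  by exists 0, 0; split=> [t|||]; rewrite ?rmorph0 ?deriv0 !horner0.
exists (x *: u - v * 'X + c%:P), (x *: v + u * 'X); split.
- move=> t; rewrite rmorphD rmorphM /= map_polyX map_polyC /= hornerD hornerMX.
  rewrite hornerC uvE !(hornerD, hornerN, hornerMX, hornerC, hornerZ) /=.
  by simpc; congr (_ +i* _); ring.
- by rewrite !(hornerD, hornerN, hornerZ, hornerMX, hornerC) u0; ring.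
- by rewrite !(hornerD, hornerZ, hornerMX) v0; ring.
- rewrite !derivD !derivZ !derivM derivX derivC.
  by rewrite !(hornerD, hornerZ, hornerMX, hornerM, hornerC) dv0 u0; ring.
Qed.

(* Nonvanishing means that [h / g] maps the upper half-plane to the closed lower
   one, so its derivative on the real line is nonpositive. *)
Lemma wronskian_le0 g h :
    (forall z y : C, 0 < complex.Im z -> 0 <= complex.Im y ->
       (toC g).[z] + y * (toC h).[z] != 0) ->
  forall x, h^`().[x] * g.[x] - h.[x] * g^`().[x] <= 0.
Proof.
move=> stable x.
have [ug [vg [gE ug0 vg0 dvg0]]] := horner_vertical_line g x.
have [uh [vh [hE uh0 vh0 dvh0]]] := horner_vertical_line h x.
(* [f.[t]] is the imaginary part of [h] times the conjugate of [g] at [x +i* t]. Where it is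
   positive, [y = - g / h] has nonnegative imaginary part and solves [g + y * h = 0], against
   stability. *)
pose f := vh * ug - uh * vg.
have -> : h^`().[x] * g.[x] - h.[x] * g^`().[x] = f^`().[0].
  rewrite derivB !derivM !(hornerD, hornerN, hornerM).
  by rewrite ug0 vg0 dvg0 uh0 vh0 dvh0; ring.
apply: deriv0_le0 => [|t t_gt0].
  by rewrite !(hornerD, hornerN, hornerM) vg0 vh0; ring.
rewrite leNgt; apply/negP; rewrite !(hornerD, hornerN, hornerM) => Im_gt0.
have n2_gt0 : 0 < uh.[t] ^+ 2 + vh.[t] ^+ 2.
  rewrite lt_neqAle addr_ge0 ?sqr_ge0 // andbT eq_sym paddr_eq0 ?sqr_ge0 //.
  rewrite !sqrf_eq0; apply/negP => /andP[/eqP uh_t /eqP vh_t].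
  by move: Im_gt0; rewrite uh_t vh_t !mul0r subrr ltxx.
have hn0 : uh.[t] +i* vh.[t] != 0.
  apply/eqP => -[uh_t vh_t].
  by move: Im_gt0; rewrite uh_t vh_t !mul0r subrr ltxx.
pose y := - (ug.[t] +i* vg.[t]) / (uh.[t] +i* vh.[t]).
have Im_y : 0 <= complex.Im y.
  rewrite /y /=; set n2 := _ + _ in n2_gt0 *.
  rewrite (_ : _ + _ = (vh.[t] * ug.[t] - uh.[t] * vg.[t]) / n2); last by ring.
  by rewrite divr_ge0 // ltW.
have /eqP := stable (x +i* t) y t_gt0 Im_y.
by apply; rewrite gE hE mulfVK // subrr.
Qed.

End Stability.

(** * Determinants under rank-one and two-row updates *)

Section Determinants.
Variables (F : comNzRingType) (n : nat).
Implicit Types (M N : 'M[F]_n) (u v : 'I_n) (a b : 'rV[F]_n).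

(** By a Schur complement, the left side is the determinant of the bordered matrix [B y], whose
    first column is affine in [y]; transposing turns this into linearity in a row. *)
Lemma det_add_rank1 M (w : 'cV[F]_n) (r : 'rV[F]_n) y :
  \det (M + y *: (w *m r)) = y * \det (M + w *m r) + (1 - y) * \det M.
Proof.
pose B t : 'M_(1 + n) := block_mx (1%:M : 'M_1) r (- t *: w) M.
have detB t : \det (B t) = \det (M + t *: (w *m r)).
  have -> : B t = block_mx 1%:M 0 (- t *: w) 1%:M *m
                  block_mx 1%:M r 0 (M + t *: (w *m r)).
    rewrite mulmx_block ?(mul1mx, mul0mx, mulmx0, mulmx1) !addr0.
    by rewrite -scalemxAl [- t *: (_ *m _)]scaleNr addrCA addNr addr0.
  by rewrite det_mulmx det_lblock det_ublock !det1 !mul1r.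
have det0 : \det M = \det (B 0) by rewrite detB scale0r addr0.
rewrite -detB -{1}[w *m r]scale1r -detB det0 -!(det_tr (B _)) !tr_block_mx.
pose i0 : 'I_n.+1 := ord0.
have i0E : i0 = lshift n ord0 :> 'I_(1 + n) by exact: val_inj.
have row'0 (a : 'rV[F]_(1 + n)) (D : 'M[F]_(n, 1 + n)) :
    row' i0 (col_mx a D) = D :> 'M_(n, 1 + n).
  apply/matrixP=> i j; rewrite mxE.
  have iE : lift i0 i = rshift 1 i :> 'I_(1 + n) by exact: val_inj.
  by rewrite [X in col_mx a D X j]iE; apply: col_mxEd.
have row0 (a : 'rV[F]_(1 + n)) (D : 'M[F]_(n, 1 + n)) :
    row i0 (col_mx a D) = a.
  by apply/rowP => j; rewrite mxE [X in col_mx a D X j]i0E; apply: col_mxEu.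
apply: (@determinant_multilinear _ _ _ _ _ i0); rewrite ?row'0 //.
rewrite !row0; apply/rowP => j; rewrite !mxE.
by case: splitP => k _; rewrite !mxE; ring.
Qed.

Definition set_rows N u v a b : 'M[F]_n :=
  \matrix_(i < n) (if i == u then a else if i == v then b else row i N).

Lemma det_set_rows_linearl N u v a a' b x :
  \det (set_rows N u v (a + x *: a') b) =
  \det (set_rows N u v a b) + x * \det (set_rows N u v a' b).
Proof.
rewrite -[X in _ = X + _]mul1r; apply: (@determinant_multilinear _ _ _ _ _ u).
  by rewrite !rowK eqxx scale1r.
all: by apply/row_matrixP => i; rewrite !row_rowsub /= !rowK
    eq_sym (negPf (neq_lift _ _)).
Qed.

Section Pair.
Variables (u v : 'I_n).
Hypothesis uv : u != v.

Lemma det_set_rows_linearr N a b b' x :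
  \det (set_rows N u v a (b + x *: b')) =
  \det (set_rows N u v a b) + x * \det (set_rows N u v a b').
Proof.
have vu : (v == u) = false by rewrite eq_sym; exact: negPf.
rewrite -[X in _ = X + _]mul1r; apply: (@determinant_multilinear _ _ _ _ _ v).
  by rewrite !rowK vu eqxx scale1r.
all: by apply/row_matrixP => i; rewrite !row_rowsub /= !rowK
    [_ == v]eq_sym (negPf (neq_lift _ _)).
Qed.

Lemma det_set_rows_alt N a b :
  \det (set_rows N u v b a) = - \det (set_rows N u v a b).
Proof.
have vu : (v == u) = false by rewrite eq_sym; exact: negPf.
have alt c : \det (set_rows N u v c c) = 0.
  by apply: (determinant_alternate uv) => j; rewrite !mxE eqxx vu eqxx.
have := alt (a + 1 *: b); rewrite det_set_rows_linearl !det_set_rows_linearr !alt.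
by rewrite !mul1r add0r addr0 => /eqP; rewrite addr_eq0 => /eqP ->; rewrite opprK.
Qed.

(** Both updates change only the rows [u] and [v], so both determinants expand by multilinearity. In
    the second one the terms linear in [c] cancel between the two signs, and exchanging the two unit
    rows leaves [c ^+ 2 * q2]. *)
Lemma det_rank2_update N :
  exists q0 q1 q2 : F,
    (forall z, \det (N + z *: (delta_mx u u + delta_mx v v)) =
       q0 + q1 * z + q2 * z ^+ 2) /\
    (forall c, c ^+ 2 = -1 ->
      \det (N - c *: (delta_mx u v - delta_mx v u)) +
      \det (N + c *: (delta_mx u v - delta_mx v u)) = (q0 - q2) *+ 2).
Proof.
pose d a b := \det (set_rows N u v a b).
pose e i : 'rV[F]_n := delta_mx 0 i.
exists (d (row u N) (row v N)), (d (e u) (row v N) + d (row u N) (e v)),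
  (d (e u) (e v)).
have vu : (v == u) = false by rewrite eq_sym; exact: negPf.
have updateE (x1 x2 x3 x4 : F) :
    N + (x1 *: delta_mx u u + x2 *: delta_mx v v) +
        (x3 *: delta_mx u v + x4 *: delta_mx v u) =
    set_rows N u v (row u N + x1 *: e u + x3 *: e v)
                   (row v N + x2 *: e v + x4 *: e u).
  apply/row_matrixP => i; rewrite rowK; apply/rowP => j; rewrite !mxE /=.
  have [->|iu] := eqVneq i u; first by rewrite !mxE (negPf uv) /=; ring.
  by have [->|iv] := eqVneq i v; rewrite !mxE /=; ring.
split=> [z|c c2].
  have -> : N + z *: (delta_mx u u + delta_mx v v) =
      N + (z *: delta_mx u u + z *: delta_mx v v) +
        (0 *: delta_mx u v + 0 *: delta_mx v u).
    by rewrite !scale0r !addr0 scalerDr.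
  rewrite updateE !scale0r !addr0 det_set_rows_linearl !det_set_rows_linearr.
  by rewrite /d; ring.
have KE x : N + x *: (delta_mx u v - delta_mx v u) =
      N + (0 *: delta_mx u u + 0 *: delta_mx v v) +
        (x *: delta_mx u v + - x *: delta_mx v u).
  by rewrite !scale0r !addr0 scalerBr scaleNr.
rewrite -scaleNr !KE !updateE !scale0r !addr0 !det_set_rows_linearl.
rewrite !det_set_rows_linearr (det_set_rows_alt N (e u) (e v)) -/(d _ _) /d.
set q0 := \det (set_rows N u v (row u N) _).
set q2 := \det (set_rows N u v (e u) (e v)).
transitivity ((q0 + c ^+ 2 * q2) *+ 2); first by ring.
by rewrite c2 mulN1r.
Qed.

End Pair.
End Determinants.

(** * Dissipative matrices and nonvanishing of signed sums of determinants *)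

Section ComplexMatrices.
Variable R : realType.
Local Notation C := R[i].
Local Notation toC := (map_poly (real_complex R)).

(* If [q0 = q2] the roots come in pairs [z], [z^-1], and one of the two has
   nonnegative imaginary part. *)
Lemma quadratic_stable (q0 q1 q2 : C) :
  (forall z, 0 <= complex.Im z -> q0 + q1 * z + q2 * z ^+ 2 != 0) -> q0 != q2.
Proof.
move=> stable; apply/eqP => q02.
have q2_n0 : q2 != 0.
  by have := stable 0 (lexx _); rewrite q02 expr0n !mulr0 !addr0.
have [z qz] : exists z, q0 + q1 * z + q2 * z ^+ 2 = 0.
  exists ((- q1 + sqrtc (q1 ^+ 2 - 4 * q0 * q2)) / (2 * q2)).
  set s := sqrtc _; have : s ^+ 2 = q1 ^+ 2 - 4 * q0 * q2 by rewrite sqr_sqrtc.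
  rewrite q02 => s2.
  rewrite (_ : _ + _ = (s ^+ 2 - (q1 ^+ 2 - 4 * q2 * q2)) / (4 * q2)).
    by rewrite s2 subrr mul0r.
  by field; rewrite q2_n0.
have [Im_ge0|Im_lt0] := leP 0 (complex.Im z).
  by have := stable z Im_ge0; rewrite qz eqxx.
have z_n0 : z != 0 by apply: contraTneq Im_lt0 => ->; rewrite ltxx.
have : 0 <= complex.Im z^-1.
  case: z z_n0 Im_lt0 {qz} => a b z_n0 /= b_lt0.
  rewrite oppr_ge0 pmulr_lle0 ?ltW // invr_gt0 ltr_wpDl ?sqr_ge0 //.
  by rewrite exprn_even_gt0 //= lt_eqF.
move=> /stable/eqP; apply; rewrite q02.
transitivity ((q0 + q1 * z + q2 * z ^+ 2) / z ^+ 2); last by rewrite qz mul0r.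
by rewrite q02; field.
Qed.

Section Matrices.
Variable n : nat.
Implicit Types (M N H D : 'M[C]_n) (e : 'I_n * 'I_n) (L : seq ('I_n * 'I_n)).

Definition ctr m p (M : 'M[C]_(m, p)) : 'M[C]_(p, m) := map_mx conjc M^T.

Lemma ctrE m p (M : 'M[C]_(m, p)) i j : ctr M i j = conjc (M j i).
Proof. by rewrite !mxE. Qed.

Lemma ctrM m p q (M : 'M[C]_(m, p)) (N : 'M[C]_(p, q)) :
  ctr (M *m N) = ctr N *m ctr M.
Proof. by rewrite /ctr trmx_mul map_mxM. Qed.

Lemma ctrK m p (M : 'M[C]_(m, p)) : ctr (ctr M) = M.
Proof. by apply/matrixP => i j; rewrite !mxE conjcK. Qed.

Lemma ctrD m p (M N : 'M[C]_(m, p)) : ctr (M + N) = ctr M + ctr N.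
Proof. by rewrite /ctr linearD map_mxD. Qed.

Lemma ctrN m p (M : 'M[C]_(m, p)) : ctr (- M) = - ctr M.
Proof. by rewrite /ctr linearN map_mxN. Qed.

Definition hermitian M := ctr M = M.

Lemma hermitianD M N : hermitian M -> hermitian N -> hermitian (M + N).
Proof. by rewrite /hermitian ctrD => -> ->. Qed.

Lemma hermitianN M : hermitian M -> hermitian (- M).
Proof. by rewrite /hermitian ctrN => ->. Qed.

Definition qform M (v : 'rV[C]_n) : C := (v *m M *m ctr v) 0 0.

Lemma qformD M N v : qform (M + N) v = qform M v + qform N v.
Proof. by rewrite /qform mulmxDr mulmxDl mxE. Qed.

Lemma qformZ z M v : qform (z *: M) v = z * qform M v.
Proof. by rewrite /qform -scalemxAr -scalemxAl mxE. Qed.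

Lemma qform_hermitian M v : hermitian M -> complex.Im (qform M v) = 0.
Proof.
move=> hM; have : conjc (qform M v) = qform M v.
  have -> : conjc (qform M v) = ctr (v *m M *m ctr v) 0 0 by rewrite ctrE.
  by rewrite !ctrM ctrK hM mulmxA.
case: (qform M v) => a b [] /eqP; rewrite eq_sym -subr_eq0 opprK => /eqP bb.
by rewrite /=; lra.
Qed.

Lemma qform_rank1 (r v : 'rV[C]_n) : 0 <= qform (ctr r *m r) v.
Proof.
rewrite /qform mulmxA -mulmxA mxE big_ord1.
have -> : (r *m ctr v) 0 0 = conjc ((v *m ctr r) 0 0).
  have -> : conjc ((v *m ctr r) 0 0) = ctr (v *m ctr r) 0 0 by rewrite ctrE.
  by rewrite ctrM ctrK.
exact: mulcJ_ge0.
Qed.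

(** The matrix counterpart of the open upper half-plane: the skew-Hermitian part of [M], divided by
    ['i], is positive definite. *)
Definition dissipative M := forall v, v != 0 -> 0 < complex.Im (qform M v).

Lemma dissipative_det M : dissipative M -> \det M != 0.
Proof.
move=> dM; apply/negP => /det0P[v /dM vM vM0].
by move: vM; rewrite /qform vM0 mul0mx mxE ltxx.
Qed.

Lemma dissipativeD_hermitian M H : dissipative M -> hermitian H ->
  dissipative (M + H).
Proof.
by move=> dM hH v /dM; rewrite qformD raddfD /= (qform_hermitian v hH) addr0.
Qed.

Lemma dissipativeD_rank1 M z (r : 'rV[C]_n) : dissipative M ->
  0 <= complex.Im z -> dissipative (M + z *: (ctr r *m r)).
Proof.
move=> dM z_ge0 v /dM Mv; rewrite qformD qformZ raddfD ltr_wpDr //.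
have := qform_rank1 r v; case: (qform _ _) => a b.
rewrite lecE /= => /andP[/eqP -> a_ge0].
by case: z z_ge0 => c d /= d_ge0; rewrite mulr0 add0r mulr_ge0.
Qed.

Lemma dissipative_scalar z : 0 < complex.Im z -> dissipative z%:M.
Proof.
move=> z_gt0 v v_n0; rewrite -scalemx1 qformZ /qform mulmx1.
have -> : (v *m ctr v) 0 0 = (\sum_i ComplexField.Normc.normc (v 0 i) ^+ 2)%:C.
  rewrite rmorph_sum mxE; apply: eq_bigr => i _ /=; rewrite !mxE -sqr_normc.
  by rewrite rmorphXn.
set t := \sum_i _; have t_gt0 : 0 < t.
  have [i vi] : exists i, v 0 i != 0 by apply/rV0Pn.
  rewrite /t (bigD1 i) //= ltr_pwDl ?sumr_ge0 // => [|j _]; last exact: sqr_ge0.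
  rewrite exprn_even_gt0 //=; apply: contraNneq vi => /ComplexField.Normc.eq0_normc ->.
  exact: eqxx.
by case: z z_gt0 => c d /= d_gt0; rewrite mulr0 add0r mulr_gt0.
Qed.

(** The contribution of a chord oriented from [e.1] to [e.2] to the Hermitian adjacency matrix; the
    opposite orientation contributes [- hop e]. *)
Definition hop e : 'M[C]_n := 'i *: (delta_mx e.1 e.2 - delta_mx e.2 e.1).

(** One matrix per choice of signs, kept with multiplicity, so that a sum over this list is an
    average up to the factor [size (signings L)]. *)
Fixpoint signings L : seq 'M[C]_n :=
  if L is e :: L' then
    [seq D + hop e | D <- signings L'] ++ [seq D - hop e | D <- signings L']
  else [:: 0].

Lemma hermitian_hop e : hermitian (hop e).
Proof.
apply/matrixP => i j; rewrite !mxE.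
have -> : (i == e.2) && (j == e.1) = (j == e.1) && (i == e.2) by rewrite andbC.
have -> : (i == e.1) && (j == e.2) = (j == e.2) && (i == e.1) by rewrite andbC.
rewrite rmorphM rmorphB !rmorph_nat /= -[0 -i* 1]/('i^*).
have -> : 'i^* = - 'i :> C by simpc.
by rewrite mulNr -mulrN opprB.
Qed.

Lemma hermitian_signings L D : D \in signings L -> hermitian D.
Proof.
elim: L D => [|e L IH] D /=.
  by rewrite inE => /eqP ->; apply/matrixP => i j; rewrite !mxE conjc0.
rewrite mem_cat => /orP[] /mapP[D' /IH hD' ->].
  exact/hermitianD/hermitian_hop.
exact/hermitianD/hermitianN/hermitian_hop.
Qed.

(** The row [r] has entry [1] at [e.1] and ['i] up to sign at [e.2]: adding the same diagonal to
    either orientation of a chord gives a rank-one matrix. *)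
Lemma rank1_hop e (b : bool) : exists r : 'rV[C]_n,
  ctr r *m r = delta_mx e.1 e.1 + delta_mx e.2 e.2 + (-1) ^+ b *: hop e.
Proof.
exists (delta_mx 0 e.1 + ((-1) ^+ b * 'i) *: delta_mx 0 e.2).
apply/matrixP => i j; rewrite mxE big_ord1 !mxE /=.
rewrite rmorphD rmorphM rmorphM rmorph_sign !rmorph_nat /=.
have -> : 0 -i* 1 = - 'i :> C by simpc.
have i2 : 'i * 'i = -1 :> C by rewrite -expr2 sqr_i.
rewrite -!mulnb !natrM.
set x := (i == _)%:R; set y := (j == _)%:R.
set x' := (i == _)%:R; set y' := (j == _)%:R.
transitivity (x * y - ((-1) ^+ b * (-1) ^+ b) * ('i * 'i) * (x' * y')
   + (-1) ^+ b * ('i * (x * y' - x' * y))); first by ring.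
by rewrite -expr2 sqrr_sign i2; ring.
Qed.

Lemma delta_rank1 (i : 'I_n) :
  delta_mx i i = ctr (delta_mx 0 i : 'rV[C]_n) *m delta_mx 0 i.
Proof.
apply/matrixP => j k; rewrite [RHS]mxE big_ord1 !mxE rmorph_nat /=.
by rewrite -natrM mulnb.
Qed.

Lemma sum_det_rank2_update M (u v : 'I_n) (s : seq 'M[C]_n) : u != v ->
  exists q0 q1 q2 : C,
    (forall z, \sum_(D <- s) \det (M + z *: (delta_mx u u + delta_mx v v) - D) =
       q0 + q1 * z + q2 * z ^+ 2) /\
    \sum_(D <- s) (\det (M - (D + hop (u, v))) + \det (M - (D - hop (u, v)))) =
       (q0 - q2) *+ 2.
Proof.
move=> uv; elim: s => [|D s [p0 [p1 [p2 [pE p02]]]]].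
  exists 0, 0, 0; split=> [z|]; rewrite !big_nil; first by ring.
  by rewrite subrr mul0rn.
have [q0 [q1 [q2 [qE q02]]]] := det_rank2_update uv (M - D).
exists (q0 + p0), (q1 + p1), (q2 + p2); split=> [z|].
  by rewrite big_cons pE addrAC qE; ring.
rewrite big_cons p02 !opprD opprK !addrA (q02 'i) ?sqr_i //.
by ring.
Qed.

(* By [sum_det_rank2_update], averaging over the sign of the first chord turns
   a quadratic polynomial in [z], which by induction does not vanish for
   [Im z >= 0], into the difference of its extreme coefficients. *)
Lemma sum_det_neq0 L M : all (fun e => e.1 != e.2) L -> dissipative M ->
  \sum_(D <- signings L) \det (M - D) != 0.
Proof.
elim: L M => [|e L IH] M /=.
  by move=> _ /dissipative_det; rewrite big_seq1 subr0.
move=> /andP[uv /IH{IH}IH] dM.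
rewrite big_cat /= !big_map -big_split /=.
have [q0 [q1 [q2 [qE]]]] := sum_det_rank2_update M (signings L) uv.
rewrite -surjective_pairing => ->; rewrite mulrn_eq0 /= subr_eq0.
apply: (@quadratic_stable _ q1) => z z_ge0; rewrite -qE; apply: IH.
(* The diagonal update is a sum of two rank-one terms with coefficient [z], each of which preserves
   dissipativity. *)
rewrite scalerDr addrA !delta_rank1.
by do 2!apply: dissipativeD_rank1 => //.
Qed.

End Matrices.
End ComplexMatrices.

(** * The interlacing family of sums of characteristic polynomials *)

Section Interlacing.
Variable R : realType.
Local Notation C := R[i].
Local Notation toC := (map_poly (real_complex R)).

(** Loses nothing on characteristic polynomials of Hermitian matrices, whose coefficients are
    real. *)
Definition re_poly (p : {poly C}) : {poly R} := map_poly (@complex.Re R) p.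

Lemma coef_re_poly p k : (re_poly p)`_k = complex.Re p`_k.
Proof. by rewrite coef_map_id0. Qed.

Lemma re_poly_monic p : p \is monic ->
  re_poly p \is monic /\ size (re_poly p) = size p.
Proof.
move=> p_monic.
have s_p : size (re_poly p) = size p.
  apply: size_map_poly_id0; by rewrite (monicP p_monic) /= oner_eq0.
by split=> //; rewrite monicE lead_coefE s_p coef_re_poly -lead_coefE (monicP p_monic).
Qed.

(** Only a size bound and a coefficient are given, because the count may vanish in a ring of
    positive characteristic. *)
Lemma sum_monic (S : nzRingType) (s : seq {poly S}) k :
    (forall p, p \in s -> p \is monic /\ size p = k.+1) ->
  (size (\sum_(p <- s) p)%R <= k.+1)%N /\ (\sum_(p <- s) p)`_k = (size s)%:R.
Proof.
elim: s => [|p s IH] s_monic; first by rewrite big_nil size_poly0 coef0.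
have [|s_le lc_s] := IH; first by move=> q qs; apply: s_monic; rewrite inE qs orbT.
have [p_monic s_p] := s_monic p (mem_head _ _).
rewrite big_cons coefD lc_s; split.
  by apply: leq_trans (size_polyD _ _) _; rewrite geq_max s_p leqnn.
by rewrite -[k in p`_k]/k.+1.-1 -s_p -lead_coefE (monicP p_monic) -natr1 addrC.
Qed.

Lemma char_poly_tr (S : comNzRingType) m (M : 'M[S]_m) : char_poly M^T = char_poly M.
Proof.
rewrite /char_poly -det_tr; have -> // : (char_poly_mx M^T)^T = char_poly_mx M.
by apply/matrixP => i j; rewrite !mxE eq_sym.
Qed.

Lemma size_sub_lead (S : nzRingType) (p q : {poly S}) :
    (0 < size p)%N -> size p = size q -> lead_coef p = lead_coef q ->
  (size (p - q)%R < size p)%N.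
Proof.
rewrite !lead_coefE => p_gt0 spq pq; rewrite -[X in (_ < X)%N](prednK p_gt0) ltnS.
apply/leq_sizeP => j; rewrite leq_eqVlt => /orP[/eqP <-|].
  by rewrite coefB pq spq subrr.
by rewrite (prednK p_gt0) => pj; rewrite coefB !nth_default ?subrr // -spq.
Qed.

Variable n : nat.
Implicit Types (M N H D : 'M[C]_n) (e : 'I_n * 'I_n) (L : seq ('I_n * 'I_n)).

(** Conjugating [H] transposes it, which preserves the characteristic polynomial, so every
    coefficient is its own conjugate. *)
Lemma hermitian_char_poly H : hermitian H ->
  toC (re_poly (char_poly H)) = char_poly H.
Proof.
move=> hH; apply/polyP => k; rewrite coef_map coef_re_poly /=.
have : conjc (char_poly H)`_k = (char_poly H)`_k.
  rewrite -coef_map map_char_poly -[in RHS](char_poly_tr H).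
  rewrite (_ : map_mx _ _ = H^T) //; apply/matrixP => i j.
  by rewrite -{1}hH !mxE /= conjcK.
case: _`_k => a b [] /eqP; rewrite eq_sym -subr_eq0 opprK => /eqP bb.
by congr (_ +i* _); lra.
Qed.

Lemma horner_char_poly H z : (char_poly H).[z] = \det (z%:M - H).
Proof.
rewrite /char_poly -horner_evalE -det_map_mx; congr (\det _).
by apply/matrixP => i j; rewrite !mxE /= horner_evalE !hornerE hornerMn hornerX.
Qed.

(** A node of the interlacing family: [H] collects the tree and the chords already oriented, [L] the
    chords still free. *)
Definition charsum L H : {poly R} :=
  \sum_(D <- signings R L) re_poly (char_poly (H + D)).

Lemma charsum_cons e L H :
  charsum (e :: L) H = charsum L (H + hop R e) + charsum L (H - hop R e).
Proof.
rewrite /charsum /= big_cat /= !big_map.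
have shiftE N D : H + (D + N) = H + N + D by rewrite (addrC D) addrA.
by apply: (f_equal2 (fun p q => p + q)); apply: eq_bigr => D _; rewrite shiftE.
Qed.

Lemma toC_charsum L H : hermitian H ->
  toC (charsum L H) = \sum_(D <- signings R L) char_poly (H + D).
Proof.
move=> hH; rewrite rmorph_sum big_seq [RHS]big_seq.
by apply: eq_bigr => D /hermitian_signings hD; apply/hermitian_char_poly/hermitianD.
Qed.

Lemma horner_charsum L H z : hermitian H ->
  (toC (charsum L H)).[z] = \sum_(D <- signings R L) \det (z%:M - H - D).
Proof.
move=> hH; rewrite toC_charsum // horner_sum; apply: eq_bigr => D _.
by rewrite horner_char_poly opprD addrA.
Qed.

Lemma size_signings L : (0 < size (signings R L))%N.
Proof. by elim: L => //= e L IH; rewrite size_cat size_map ltn_addr. Qed.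

Lemma charsum_size L H : size (charsum L H) = n.+1 /\
  lead_coef (charsum L H) = (size (signings R L))%:R.
Proof.
have [|s_le lc] := @sum_monic R [seq re_poly (char_poly (H + D)) | D <- signings R L] n.
  move=> p /mapP[D _ ->].
  have [? ->] := re_poly_monic (char_poly_monic (H + D)).
  by rewrite size_char_poly.
move: s_le lc; rewrite big_map size_map -/(charsum L H) => s_le lc.
have s_c : size (charsum L H) = n.+1.
  apply/eqP; rewrite eqn_leq s_le ltnNge; apply/negP => s_lt.
  move: lc; rewrite nth_default // => /esym/eqP.
  by rewrite pnatr_eq0 -leqn0 leqNgt size_signings.
by rewrite lead_coefE s_c.
Qed.

(** With [g] and [f] the two sums, [det_add_rank1] turns [g + y * (g - f)] at [z] into a sum of
    determinants based at [z%:M - G + y *: (ctr r *m r)]. This matrix is dissipative, so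
    [sum_det_neq0] gives the nonvanishing that [wronskian_le0] requires. *)
Lemma charsum_wronskian L G (r : 'rV[C]_n) x :
    all (fun e => e.1 != e.2) L -> hermitian G -> hermitian (G + ctr r *m r) ->
  (charsum L G - charsum L (G + ctr r *m r))^`().[x] * (charsum L G).[x] -
  (charsum L G - charsum L (G + ctr r *m r)).[x] * (charsum L G)^`().[x] <= 0.
Proof.
move=> dL hG hGr; apply: wronskian_le0 => z y z_gt0 y_ge0.
move: (horner_charsum L z hG) (horner_charsum L z hGr).
move: (charsum L G) (charsum L _) => g f gE fE.
rewrite rmorphB hornerD hornerN {}gE {}fE -sumrB mulr_sumr -big_split /=.
have := sum_det_neq0 dL (dissipativeD_rank1 r
  (dissipativeD_hermitian (dissipative_scalar z_gt0) (hermitianN hG)) y_ge0).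
congr (_ != _); apply: eq_bigr => D _.
have -> : y *: (ctr r *m r) = - y *: (- ctr r *m r).
  by rewrite mulNmx scaleNr scalerN opprK.
rewrite addrAC det_add_rank1 mulNmx.
have -> : z%:M - (G + ctr r *m r) - D = z%:M - G - D - ctr r *m r.
  by rewrite opprD !addrA [LHS]addrAC.
by move: (\det _) (\det _) => d1 d2; ring.
Qed.

Lemma charsum_size_sub L G H :
  (size (charsum L G - charsum L H)%R < size (charsum L G))%N.
Proof.
have [sG lG] := charsum_size L G; have [sH lH] := charsum_size L H.
apply: size_sub_lead; first by rewrite sG.
  exact: etrans sG (esym sH).
exact: etrans lG (esym lH).
Qed.

(* [hop e] and [- hop e] both become rank-one updates after adding the same
   diagonal matrix, so the two halves of the sum are interlaced by one
   polynomial. *)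
Lemma charsum_half t e L H :
    e.1 != e.2 -> all (fun e => e.1 != e.2) L -> hermitian H ->
    pos_above t (charsum (e :: L) H) ->
  pos_above t (charsum L (H + hop R e)) \/
  pos_above t (charsum L (H - hop R e)).
Proof.
move=> e12 dL hH.
have [r0 r0E] := rank1_hop R e false; have [r1 r1E] := rank1_hop R e true.
rewrite expr0 scale1r in r0E; rewrite expr1 scaleN1r in r1E.
pose A : 'M[C]_n := delta_mx e.1 e.1 + delta_mx e.2 e.2.
have hA : hermitian A.
  by apply: hermitianD; rewrite /hermitian delta_rank1 ctrM ctrK.
have Gr0 : H + hop R e = H - A + ctr r0 *m r0 by rewrite r0E addrA subrK.
have Gr1 : H - hop R e = H - A + ctr r1 *m r1 by rewrite r1E addrA subrK.
have hG : hermitian (H - A) by apply/hermitianD/hermitianN.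
have hG0 : hermitian (H - A + ctr r0 *m r0).
  by rewrite -Gr0; apply/hermitianD/hermitian_hop.
have hG1 : hermitian (H - A + ctr r1 *m r1).
  by rewrite -Gr1; apply/hermitianD/hermitianN/hermitian_hop.
rewrite charsum_cons Gr0 Gr1.
have [_ lcg] := charsum_size L (H - A).
have W0 x := charsum_wronskian x dL hG hG0.
have W1 x := charsum_wronskian x dL hG hG1.
have s0 := charsum_size_sub L (H - A) (H - A + ctr r0 *m r0).
have s1 := charsum_size_sub L (H - A) (H - A + ctr r1 *m r1).
move: lcg W0 W1 s0 s1; move: (charsum L _) (charsum L _) (charsum L _).
move=> f1 f0 g lcg W0 W1 s0 s1.
rewrite -[f0](subKr g) -[f1](subKr g); apply: pos_above_half => //.
by rewrite lcg ltr0n size_signings.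
Qed.

Lemma exists_signing t L H : all (fun e => e.1 != e.2) L -> hermitian H ->
    pos_above t (charsum L H) ->
  exists2 D, D \in signings R L & pos_above t (re_poly (char_poly (H + D))).
Proof.
elim: L H => [|e L IH] H /=.
  by move=> _ _; rewrite /charsum big_seq1; exists 0; rewrite ?inE.
move=> /andP[e12 dL] hH /(charsum_half e12 dL hH)[] /IH[||D DL D_pos] //.
- exact/hermitianD/hermitian_hop.
- exists (D + hop R e); last by rewrite [D + _]addrC addrA.
  by rewrite mem_cat; apply/orP; left; apply/mapP; exists D.
- exact/hermitianD/hermitianN/hermitian_hop.
- exists (D - hop R e); last by rewrite [D - _]addrC addrA.
  by rewrite mem_cat; apply/orP; right; apply/mapP; exists D.
Qed.

End Interlacing.

(** * Cycle structure and sign of involutions *)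

Section Involutions.
Variable n : nat.

(** For an involution these are the smaller elements of the 2-cycles, so their number counts the
    transpositions. *)
Definition ascents (s : 'S_n) : {set 'I_n} := [set i : 'I_n | (i < s i)%N]%SET.

Variable s : 'S_n.
Hypothesis sK : involutive s.

Lemma card_descents : #|[pred i : 'I_n | (s i < i)%N]| = #|ascents s|.
Proof.
rewrite -(card_imset (mem (ascents s)) (@perm_inj _ s)).
apply: eq_card => i; rewrite !inE.
apply/idP/imsetP => [si|[j]]; last by rewrite inE => js ->; rewrite sK.
by exists (s i); rewrite ?inE sK.
Qed.

Lemma card_fixed : (#|[pred i | s i == i]| + (#|ascents s|).*2 = n)%N.
Proof.
rewrite -addnn -{2}card_descents -[RHS]card_ord -!sum1_card.
rewrite [RHS](bigID (fun i => s i == i)) /=; congr addn.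
rewrite [RHS](bigID (fun i : 'I_n => (i < s i)%N)) /=.
congr addn; apply: eq_bigl => i; rewrite !inE -val_eqE /=; lia.
Qed.

Lemma prod_involution (S : comNzRingType) (F : 'I_n -> S) (x : S) :
    (forall i, s i = i -> F i = x) ->
    (forall i, s i != i -> F i * F (s i) = 1) ->
  \prod_i F i = x ^+ (n - (#|ascents s|).*2).
Proof.
move=> Fx F1; rewrite (bigID (fun i => s i == i)) /=.
rewrite (eq_bigr (fun=> x)) => [|i /eqP/Fx //]; rewrite prodr_const.
have -> : (n - (#|ascents s|).*2)%N = #|[pred i | s i == i]|.
  by rewrite -[X in (X - _)%N]card_fixed addnK.
rewrite (bigID (fun i : 'I_n => (i < s i)%N)) /=.
rewrite [X in _ * (_ * X)](reindex_inj (@perm_inj _ s)) /=.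
rewrite [X in _ * (_ * X)](eq_bigl (fun i => (s i != i) && (i < s i)%N)).
  by rewrite -big_split big1 ?mulr1 //= => i /andP[si _]; apply: F1.
by move=> i; rewrite sK -!val_eqE /=; lia.
Qed.

Lemma mem_porbit_involution i j : j \in porbit s i -> j = i \/ j = s i.
Proof.
case/porbitP => k ->; elim: k => [|k [IH|IH]]; first by left; rewrite expg0 perm1.
  by right; rewrite expgSr permM IH.
by left; rewrite expgSr permM IH sK.
Qed.

(** Every cycle contains exactly one point that is not a descent, so the number of cycles is [n]
    minus the number of descents. *)
Lemma odd_involution : odd_perm s = odd #|ascents s| :> bool.
Proof.
have card_porbits : #|porbits s| = #|[predC [pred i : 'I_n | (s i < i)%N]]|.
  rewrite -(@card_in_imset _ _ (porbit s)) => [|i j].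
    apply: eq_card => O; apply/imsetP/imsetP => [[i _ ->]|[i _ ->]]; last by exists i.
    have [si|si] := ltnP (s i) i; last by exists i; rewrite ?inE -?leqNgt.
    exists (s i); first by rewrite !inE sK -leqNgt ltnW.
    by have := porbit_perm s 1 i; rewrite expg1 => ->.
  rewrite !inE -!leqNgt => i_le j_le ij.
  have : j \in porbit s i by rewrite ij porbit_id.
  case/mem_porbit_involution => [//|ji]; apply/val_inj/eqP.
  by move: j_le i_le; rewrite ji sK eqn_leq => -> ->.
have := cardC [pred i : 'I_n | (s i < i)%N]; rewrite -card_porbits card_descents.
by rewrite /odd_perm => <-; rewrite oddD -addbA addbb addbF.
Qed.

End Involutions.

(** * Matchings as involutions, and the matching polynomial *)

Section Matchings.
Variables (V : finType) (G : sgraph V).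
Local Notation n := #|V|.
Local Notation phi := (@enum_val V predT).
Implicit Types s t : 'S_n.

(** Encodes a matching: the 2-cycles are its edges, the fixed points its uncovered vertices. *)
Definition matching_perm (s : 'S_n) : bool :=
  [forall i, (s (s i) == i) && ((s i != i) ==> G (phi i) (phi (s i)))].

Lemma matching_permP (s : 'S_n) :
  reflect (involutive s /\ forall i, s i != i -> G (phi i) (phi (s i)))
          (matching_perm s).
Proof.
apply: (iffP forallP) => [sP|[sK sG] i]; last by rewrite sK eqxx; apply/implyP/sG.
by split=> i; have /andP[/eqP ? /implyP] := sP i.
Qed.

Definition pair_block (i j : 'I_n) : {set V} := [set phi i; phi j]%SET.

Lemma eq_pair_block i j k l : i != j -> pair_block i j = pair_block k l ->
  (i = k /\ j = l) \/ (i = l /\ j = k).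
Proof.
move=> ij /setP eq_s; have := eq_s (phi i); have := eq_s (phi j).
rewrite !inE !eqxx orbT /= !(inj_eq enum_val_inj) => /esym jkl /esym ikl.
case/orP: ikl ij jkl => /eqP -> ij /orP[] /eqP E; rewrite E ?eqxx // in ij *.
- by left.
- by right.
Qed.

Lemma pair_blockC i j : pair_block i j = pair_block j i.
Proof. by apply/setP => x; rewrite !inE orbC. Qed.

Lemma pair_block_edge i j : G (phi i) (phi j) -> pair_block i j \in edges G.
Proof.
move=> Gij; apply/imsetP; exists (phi i, phi j); first by rewrite inE.
by apply/setP => x; rewrite !inE.
Qed.

Lemma edgeP e : e \in edges G ->
  exists i j, [/\ i != j, G (phi i) (phi j) & e = pair_block i j].
Proof.
case/imsetP => -[a b]; rewrite inE /= => Gab ->.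
exists (enum_rank a), (enum_rank b); rewrite !enum_rankK; split => //.
  by apply: contraTneq Gab => /enum_rank_inj ->; rewrite adj_irr.
by apply/setP => x; rewrite !inE !enum_rankK.
Qed.

Definition perm_matching (s : 'S_n) : {set {set V}} :=
  imset (fun i => pair_block i (s i)) (mem (ascents s)).

Lemma mem_perm_matching s i : involutive s -> s i != i ->
  pair_block i (s i) \in perm_matching s.
Proof.
move=> sK si; have [i_lt|i_ge] := ltnP i (s i).
  by apply/imsetP; exists i; rewrite ?inE.
apply/imsetP; exists (s i); last by rewrite sK pair_blockC.
by rewrite inE sK ltn_neqAle i_ge andbT.
Qed.

Lemma perm_matching_in s : matching_perm s ->
  perm_matching s \in matchings G #|ascents s|.
Proof.
move=> /matching_permP[sK sG]; rewrite inE; apply/and3P; split.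
- apply/fintype.subsetP => _ /imsetP[i i_asc ->]; apply/pair_block_edge/sG.
  by move: i_asc; rewrite inE; case: eqP => // ->; rewrite ltnn.
- apply/finset.trivIsetP => _ _ /imsetP[i _ ->] /imsetP[j _ ->].
  apply: contraR => /pred0Pn[x /=]; rewrite !inE.
  case/andP => /orP[] /eqP -> ; rewrite !(inj_eq enum_val_inj) => /orP[] /eqP.
  + by move=> ->.
  + by move=> ->; rewrite sK pair_blockC.
  + by move=> <-; rewrite sK pair_blockC.
  + by move/perm_inj => ->.
- rewrite card_in_imset // => i j; rewrite !inE => i_lt j_lt.
  case/eq_pair_block => [|[]//|[i_sj si_j]]; first by rewrite -val_eqE /= ltn_eqF.
  by move: i_lt; rewrite si_j {1}i_sj ltnNge (ltnW j_lt).
Qed.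

Lemma perm_matching_inj : {in [pred s | matching_perm s] &, injective perm_matching}.
Proof.
move=> s t; rewrite !inE => /matching_permP[sK _] /matching_permP[tK _] st.
have sub (u w : 'S_n) i : involutive u -> involutive w ->
    perm_matching u = perm_matching w ->
    u i != i -> w i = u i.
  move=> uK wK uw ui; have := mem_perm_matching uK ui; rewrite uw => /imsetP[j _].
  by rewrite eq_sym in ui; case/(eq_pair_block ui) => [[-> ->]|[-> ->]]; rewrite ?wK.
apply/permP => i; have [si|si] := eqVneq (s i) i; last by rewrite (sub s t).
by have [ti|ti] := eqVneq (t i) i; [rewrite si ti | rewrite (sub t s)].
Qed.

Lemma perm_matching_onto k M : M \in matchings G k ->
  exists2 s, matching_perm s & perm_matching s = M.
Proof.
rewrite inE => /and3P[/fintype.subsetP M_edges /finset.trivIsetP M_triv _].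
have partner i j l : j != i -> l != i ->
    pair_block i j \in M -> pair_block i l \in M -> j = l.
  move=> ji li ijM ilM; have [E|ne] := eqVneq (pair_block i j) (pair_block i l).
    rewrite eq_sym in ji.
    by case: (eq_pair_block ji E) => [[]//|[_ j_i]]; rewrite j_i eqxx in ji.
  have /pred0P/(_ (phi i)) := M_triv _ _ ijM ilM ne.
  by rewrite /= !inE !eqxx.
(* [f] sends a vertex to its partner in [M]; the default [i] makes uncovered vertices fixed
   points. *)
pose f i := if [pick j | (j != i) && (pair_block i j \in M)] is Some j then j else i.
have fE i j : j != i -> pair_block i j \in M -> f i = j.
  move=> ji ijM; rewrite /f; case: pickP => [l /andP[li ilM]|/(_ j)].
    exact: (partner i).
  by rewrite ji ijM.
have fM i : f i != i -> pair_block i (f i) \in M.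
  by rewrite /f; case: pickP => [j /andP[]|] //; rewrite eqxx.
have fK : involutive f.
  move=> i; have [fi|fi] := eqVneq (f i) i; first by rewrite !fi.
  by apply: (fE (f i) i); rewrite 1?eq_sym // pair_blockC fM.
pose s := perm (inv_inj fK).
have sK : involutive s by move=> i; rewrite !permE.
exists s.
  apply/matching_permP; split=> // i; rewrite permE => /fM/M_edges/edgeP[j [l [jl Gjl]]].
  move/esym/(eq_pair_block jl) => E; case: E Gjl => -[-> ->] //.
  by rewrite adj_sym.
apply/setP => e; apply/imsetP/idP => [[ i ]|eM].
  rewrite inE permE => i_lt ->; apply: fM.
  by apply: contraTneq i_lt => ->; rewrite ltnn.
have [i [j [ij _ eE]]] := edgeP (M_edges _ eM).
have fi : f i = j by apply: fE; rewrite 1?eq_sym // -eE.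
have := @mem_perm_matching s i sK; rewrite permE fi eq_sym => /(_ ij)/imsetP.
by rewrite eE.
Qed.

Lemma sum_matching_perm (S : nzRingType) :
  \sum_(s : 'S_n | matching_perm s)
     (-1) ^+ #|ascents s| *: 'X^(n - (#|ascents s|).*2) = matching_poly G S.
Proof.
have asc_le s : matching_perm s -> (#|ascents s| < n./2.+1)%N.
  move=> /matching_permP[sK _]; rewrite ltnS -[X in (X <= _)%N]doubleK half_leq //.
  by rewrite -[X in (_ <= X)%N](card_fixed sK) leq_addl.
(* Grouping by number of transpositions; [asc_le] ensures that [inord] does not truncate it. *)
rewrite (partition_big (fun s => inord #|ascents s| : 'I_(n./2).+1) predT) //=.
rewrite /matching_poly; apply: eq_bigr => k _.
have cardE : #|[pred s | matching_perm s & #|ascents s| == k]| = #|matchings G k|.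
  rewrite -(@card_in_imset _ _ perm_matching); last first.
    by move=> s t /andP[sM _] /andP[tM _]; apply: perm_matching_inj.
  apply: eq_card => M; apply/imsetP/idP => [[s]|MM].
    by rewrite inE => /andP[/perm_matching_in sM /eqP <-] ->.
  have [s sM sE] := perm_matching_onto MM; exists s => //.
  rewrite inE sM; have := perm_matching_in sM; rewrite sE !inE.
  by move: MM; rewrite inE => /and3P[_ _ /eqP ->] /and3P[_ _]; rewrite eq_sym.
rewrite -cardE (eq_bigl (mem [pred s | matching_perm s & #|ascents s| == k])).
  rewrite (eq_bigr (fun=> (-1) ^+ k *: 'X^(n - k.*2))) => [|s]; last first.
    by rewrite inE => /andP[_ /eqP ->].
  by rewrite sumr_const -scaler_nat scalerA -[_ * _]commr_nat.
move=> s; rewrite !inE; case sM: (matching_perm s) => //=.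
by rewrite -val_eqE /= inordK // asc_le.
Qed.

End Matchings.

(** * Entries of signed matrices and cancellation between opposite signs *)

Section SigningEntries.
Variables (R : realType) (n : nat).
Local Notation C := R[i].
Implicit Types (M D : 'M[C]_n) (e : 'I_n * 'I_n) (L : seq ('I_n * 'I_n)).

Local Notation ordered L := (all (fun e : 'I_n * 'I_n => (e.1 < e.2)%N) L).

Lemma hopE e u v : hop R e u v = 'i * ((e == (u, v))%:Z - (e == (v, u))%:Z)%:~R.
Proof.
case: e => a b; rewrite !mxE /= !xpair_eqE rmorphB /= !pmulrn.
by rewrite ![_ == u]eq_sym ![_ == v]eq_sym [(v == a) && _]andbC.
Qed.

(** As [L] is duplicate-free and its pairs are increasing, each entry receives a contribution from
    at most one chord and so stays within [0], [1], [-1] times ['i]. *)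
Lemma signing_entries L D : uniq L -> ordered L -> D \in signings R L ->
  exists S : 'I_n -> 'I_n -> int, forall u v,
    [/\ D u v = 'i * (S u v)%:~R, S u v = - S v u, S u v \in [:: 0; 1; -1]
      & (S u v != 0) = ((u, v) \in L) || ((v, u) \in L)].
Proof.
elim: L D => [|e L IH] D /=.
  move=> _ _; rewrite inE => /eqP ->; exists (fun _ _ => 0) => u v.
  by rewrite mxE mulr0z mulr0 oppr0 eqxx.
move=> /andP[eL uL] /andP[e_lt oL] DL.
have [D' [b [D'L ->]]] : exists D' b, D' \in signings R L /\
    D = D' + (-1) ^+ nat_of_bool b *: hop R e.
  move: DL; rewrite mem_cat => /orP[] /mapP[D' D'L ->]; exists D'.
    by exists false; rewrite expr0 scale1r.
  by exists true; rewrite expr1 scaleN1r.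
have [S SP] := IH D' uL oL D'L.
exists (fun u v => S u v + (-1) ^+ b * ((e == (u, v))%:Z - (e == (v, u))%:Z)) => u v.
have [DS Santi S01 Sn0] := SP u v.
have lt_of x y : (x, y) \in L -> (x < y)%N by move/(allP oL).
have asym x y : e = (x, y) -> (e == (y, x)) = false.
  move=> exy; move: e_lt; rewrite exy xpair_eqE /= => xy.
  by apply/negP => /andP[/eqP yx _]; rewrite yx ltnn in xy.
have S0 : e == (u, v) \/ e == (v, u) -> S u v = 0.
  move=> euv; apply/eqP/negPn; rewrite Sn0.
  case: euv eL e_lt => /eqP -> /= /negPf -> ?; rewrite ?orbF;
    by apply/negP => /lt_of; lia.
split.
- rewrite mxE [X in _ + X]mxE hopE DS [(S u v + _)%:~R]intrD [RHS]mulrDr.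
  congr (_ + _).
  by case: (b); rewrite ?expr0 ?expr1 ?mul1r ?mulN1r ?mulrNz ?mulrN.
- by rewrite Santi; ring.
- have [euv|uv] := eqVneq e (u, v).
    by rewrite (asym _ _ euv) S0 ?euv ?eqxx; [case: b | left].
  have [evu|vu] := eqVneq e (v, u); last by rewrite subrr mulr0 addr0.
  by rewrite S0 ?evu ?eqxx; [case: b | right].
- rewrite !inE ![(_, _) == e]eq_sym.
  have [euv|uv] := eqVneq e (u, v).
    by rewrite (asym _ _ euv) S0 ?euv ?eqxx; [case: b | left].
  have [evu|vu] := eqVneq e (v, u); last by rewrite subrr mulr0 addr0 /= Sn0.
  by rewrite S0 ?evu ?eqxx ?orbT; [case: b | right].
Qed.

Lemma hop_disjoint e u v : e != (u, v) -> e != (v, u) -> hop R e u v = 0.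
Proof. by rewrite hopE => /negPf -> /negPf ->; rewrite subrr mulr0. Qed.

(** The induction generalizes over [F]: a chord other than [e] is absorbed by replacing [F] with the
    sum of its two shifts along that chord. *)
Lemma signings_cancel (S : nmodType) (F : 'M[C]_n -> S) L e :
    uniq L -> ordered L -> e \in L ->
    (forall M, M e.1 e.2 = 0 -> M e.2 e.1 = 0 ->
       F (M + hop R e) + F (M - hop R e) = 0) ->
  \sum_(D <- signings R L) F D = 0.
Proof.
elim: L F => [|e' L IH] F //= /andP[e'L uL] /andP[e'_lt oL].
rewrite inE => eL FP; rewrite big_cat /= !big_map -big_split /=.
have lt_of x y : (x, y) \in L -> (x < y)%N by move/(allP oL).
move: eL; have [ee' _|ee' /= eL] := eqVneq e e'.
  rewrite big_seq big1 // => D DL; rewrite -ee'; apply: FP.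
    have [S0 SP] := signing_entries uL oL DL; have [-> _ _ Sn0] := SP e.1 e.2.
    rewrite (_ : S0 _ _ = 0) ?mulr0 //; apply/eqP/negPn; rewrite Sn0.
    rewrite -surjective_pairing ee' (negPf e'L) /=; apply/negP => /lt_of; lia.
  have [S0 SP] := signing_entries uL oL DL; have [-> _ _ Sn0] := SP e.2 e.1.
  rewrite (_ : S0 _ _ = 0) ?mulr0 //; apply/eqP/negPn; rewrite Sn0.
  rewrite orbC -surjective_pairing ee' (negPf e'L) /=; apply/negP => /lt_of; lia.
have e_lt : (e.1 < e.2)%N by exact: (allP oL).
have e'1 : e' != (e.1, e.2) by rewrite -surjective_pairing eq_sym.
have e'2 : e' != (e.2, e.1) by apply: contraTneq e'_lt => ->; rewrite /= -leqNgt ltnW.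
apply: (IH (fun D => F (D + hop R e') + F (D - hop R e'))) => // M M12 M21.
rewrite addrACA ![M + hop R e + _]addrAC ![M - hop R e + _]addrAC.
have h12 : hop R e' e.1 e.2 = 0 by apply: hop_disjoint.
have h21 : hop R e' e.2 e.1 = 0 by apply: hop_disjoint.
rewrite !FP ?addr0 //; rewrite mxE ?[(- hop R e') _ _]mxE;
  by rewrite ?M12 ?M21 ?h12 ?h21 ?subr0 ?addr0.
Qed.

End SigningEntries.

(** * The average characteristic polynomial is the matching polynomial *)

Section AverageCharPoly.
Variables (R : realType) (V : finType) (G T : sgraph V).
Hypothesis acyclicT : acyclic T.
Hypothesis subTG : subrel T G.
Local Notation n := #|V|.
Local Notation phi := (@enum_val V predT).
Local Notation C := R[i].
Implicit Types (s : 'S_n) (M D : 'M[C]_n).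

Definition chords : seq ('I_n * 'I_n) :=
  [seq e : 'I_n * 'I_n <- index_enum _ |
    [&& (e.1 < e.2)%N, G (phi e.1) (phi e.2) & ~~ T (phi e.1) (phi e.2)]].

Definition tree_mx : 'M[C]_n := \matrix_(i, j) (T (phi i) (phi j))%:R.

Lemma chords_uniq : uniq chords.
Proof. by rewrite filter_uniq // index_enum_uniq. Qed.

Lemma chords_lt : all (fun e : 'I_n * 'I_n => (e.1 < e.2)%N) chords.
Proof. by apply/allP => e; rewrite mem_filter => /andP[/and3P[]]. Qed.

Lemma mem_chords i j : ((i, j) \in chords) || ((j, i) \in chords) =
  G (phi i) (phi j) && ~~ T (phi i) (phi j).
Proof.
rewrite !mem_filter !mem_index_enum !andbT /=.
rewrite [G (phi j) _]adj_sym [T (phi j) _]adj_sym.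
have [|//|/val_inj ->] := ltngtP i j; first by rewrite /= orbF.
by rewrite adj_irr.
Qed.

Lemma signed_entries D : D \in signings R chords ->
  exists S : 'I_n -> 'I_n -> int, forall i j,
    [/\ (tree_mx + D) i j = if T (phi i) (phi j) then 1 else 'i * (S i j)%:~R,
        S i j = - S j i, S i j \in [:: 0; 1; -1]
      & (S i j != 0) = G (phi i) (phi j) && ~~ T (phi i) (phi j)].
Proof.
move=> /(signing_entries chords_uniq chords_lt)[S SP]; exists S => i j.
have [DS Santi S01 Sn0] := SP i j; rewrite mem_chords in Sn0; split=> //.
rewrite !mxE DS; case: ifP Sn0 => Tij; last by rewrite add0r.
by rewrite andbF => /negbT; rewrite negbK => /eqP ->; rewrite mulr0z mulr0 addr0.
Qed.

Lemma signed_entry0 D i j : D \in signings R chords -> ~~ G (phi i) (phi j) ->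
  (tree_mx + D) i j = 0.
Proof.
move=> /signed_entries[S SP] nG; have [-> _ _] := SP i j.
rewrite (negPf nG) /= ifN; last by apply: contra nG; apply: subTG.
by move=> /negbT; rewrite negbK => /eqP ->; rewrite mulr0z mulr0.
Qed.

Lemma signed_entry1 D i j : D \in signings R chords -> G (phi i) (phi j) ->
  (tree_mx + D) i j * (tree_mx + D) j i = 1.
Proof.
move=> /signed_entries[S SP] Gij; have [-> Santi S01] := SP i j.
have [-> _ _ _] := SP j i; rewrite [T (phi j) _]adj_sym Gij /=.
case: ifP => [_ _|_]; first by rewrite mulr1.
have S2 : S i j != 0 -> S i j * S i j = 1.
  by move: S01; rewrite !inE => /or3P[] /eqP ->; rewrite ?eqxx ?mulr1 ?mulrNN.
move=> /S2 Sij1; have -> : S j i = - S i j by rewrite Santi opprK.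
rewrite mulrACA -expr2 sqr_i -intrM mulrN Sij1.
by rewrite rmorphN1 mulrNN mulr1.
Qed.

Definition perm_prod s (M : 'M[C]_n) : {poly C} :=
  \prod_i (char_poly_mx M) i (s i).

Lemma char_poly_perm M : char_poly M = \sum_(s : 'S_n) (-1) ^+ s * perm_prod s M.
Proof. by []. Qed.

(** Such an [s] is not an involution, so it has an orbit of length at least 3; if that orbit used
    tree edges only, it would be a cycle of [T]. *)
Lemma exists_chord_in_cycle s :
    (forall i, s i != i -> G (phi i) (phi (s i))) -> ~~ matching_perm G s ->
  exists i, s (s i) != i /\ ~~ T (phi i) (phi (s i)).
Proof.
move=> sG nM.
have [i si] : exists i, s (s i) != i.
  apply/existsP; move: nM; apply: contraNT; rewrite negb_exists => /forallP sK.
  by apply/matching_permP; split=> // i; apply/eqP; rewrite -[_ == _]negbK.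
apply: contrapT => noT.
have sT j : s (s j) != j -> T (phi j) (phi (s j)).
  by move=> sj; apply/negPn/negP => nT; apply: noT; exists j.
have size_c : (2 < size (fingraph.orbit s i))%N.
  rewrite fingraph.size_orbit; have := iter_order (@perm_inj _ s) i.
  case: (fingraph.order s i) (fingraph.order_gt0 s i) => [//|[|[|//]]] _ /= E;
    move: si.
    by rewrite !E eqxx.
  by rewrite E eqxx.
apply: (@acyclicT (map phi (fingraph.orbit s i))); first by rewrite size_map.
apply/andP; split; last by rewrite map_inj_uniq ?orbit_uniq //; exact: enum_val_inj.
rewrite cycle_map; have := cycle_orbit (@perm_inj _ s) i.
(* Every point of the orbit is moved by the square of [s], because [i] is. *)
apply: (@sub_in_cycle _ [pred j | s (s j) != j]) => [j k /= sj _ /eqP <-|].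
  exact: sT.
apply/allP => j; rewrite -fconnect_orbit => /iter_findex <- /=.
by elim: (findex _ _ _) => //= k; rewrite !(inj_eq perm_inj).
Qed.

Lemma char_poly_mxE M i j :
  (char_poly_mx M) i j = 'X *+ (i == j) - (M i j)%:P :> {poly C}.
Proof. by rewrite !mxE. Qed.

Lemma perm_prodD1 s i M (N : 'M[C]_n) : s i != i ->
    (forall j, j != i -> M j (s j) = N j (s j)) ->
  perm_prod s M = - (M i (s i))%:P * \prod_(j | j != i) char_poly_mx N j (s j).
Proof.
move=> si MN; rewrite /perm_prod (bigD1 i) //= char_poly_mxE [i == _]eq_sym.
rewrite (negPf si) sub0r; congr (_ * _); apply: eq_bigr => j ji.
by rewrite !char_poly_mxE MN.
Qed.

Lemma perm_prod_matching s D : D \in signings R chords -> matching_perm G s ->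
  perm_prod s (tree_mx + D) = 'X^(n - (#|ascents s|).*2).
Proof.
move=> DL /matching_permP[sK sG]; apply: prod_involution => // i si.
  by rewrite char_poly_mxE si eqxx signed_entry0 ?adj_irr // subr0.
rewrite !char_poly_mxE sK [s i == i]eq_sym eq_sym (negPf si) !sub0r mulrNN.
by rewrite -polyCM signed_entry1 // sG.
Qed.

(* A permutation that is not a matching moves some vertex along a non-edge,
   or has a cycle of length at least 3; such a cycle contains a chord, whose
   sign occurs exactly once in the product. *)
Lemma perm_prod_cancel s : ~~ matching_perm G s ->
  \sum_(D <- signings R chords) perm_prod s (tree_mx + D) = 0.
Proof.
move=> nM.
have [sG|/existsNP[i /not_implyP[si /negP nG]]] :=
    pselect (forall i, s i != i -> G (phi i) (phi (s i))); last first.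
  rewrite big_seq big1 // => D DL; rewrite /perm_prod (bigD1 i) //=.
  rewrite char_poly_mxE [i == _]eq_sym (negPf si) signed_entry0 //.
  by rewrite polyC0 subr0 mul0r.
have [i [ssi nT]] := exists_chord_in_cycle sG nM.
have si : s i != i by apply: contraNneq ssi => si; rewrite !si.
have [e [eL eE]] : exists e, e \in chords /\ (e = (i, s i) \/ e = (s i, i)).
  have := mem_chords i (s i); rewrite sG // nT /= => /orP[] eL.
    by exists (i, s i); split=> //; left.
  by exists (s i, i); split=> //; right.
apply: (signings_cancel chords_uniq chords_lt eL) => M M12 M21.
have Mi : M i (s i) = 0 by case: eE M12 M21 => ->.
(* No other factor of the product sees the chord [e]: traversing it backwards would force
   [s (s i) = i]. *)
have h0 j : j != i -> hop R e j (s j) = 0.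
  move=> ji; have sji : s j != s i by rewrite (inj_eq perm_inj).
  have cross : ~~ ((s i == j) && (i == s j)).
    by apply: contra ssi => /andP[/eqP -> /eqP <-].
  have cross' : ~~ ((i == s j) && (s i == j)) by rewrite andbC.
  apply: hop_disjoint; case: eE => ->; rewrite xpair_eqE //.
    by rewrite eq_sym (negPf ji).
  by rewrite eq_sym (negPf sji).
have tree0 : tree_mx i (s i) = 0 by rewrite mxE (negPf nT).
have addE (N N' : 'M[C]_n) k l : (N + N') k l = N k l + N' k l by rewrite mxE.
have oppE (N : 'M[C]_n) k l : (- N) k l = - N k l by rewrite mxE.
rewrite (@perm_prodD1 s i (tree_mx + (M + hop R e)) (tree_mx + M)) //; last first.
  by move=> j ji; rewrite !addE h0 // addr0.
rewrite (@perm_prodD1 s i (tree_mx + (M - hop R e)) (tree_mx + M)) //; last first.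
  by move=> j ji; rewrite !addE oppE h0 // subr0.
rewrite !addE oppE tree0 Mi !add0r polyCN opprK.
by rewrite -mulrDl addNr mul0r.
Qed.

(** After exchanging the sums in the Leibniz expansion, only matching permutations survive, and
    their terms do not depend on the signing. *)
Lemma sum_char_poly :
  \sum_(D <- signings R chords) char_poly (tree_mx + D) =
  (size (signings R chords))%:R *: matching_poly G C.
Proof.
under eq_bigr do rewrite char_poly_perm; rewrite exchange_big /=.
rewrite (bigID (matching_perm G)) /= [X in _ + X]big1 ?addr0 => [|s nM]; last first.
  by rewrite -mulr_sumr perm_prod_cancel ?mulr0.
rewrite -sum_matching_perm scaler_sumr; apply: eq_bigr => s sM.
have [sK _] := matching_permP _ _ sM.
rewrite big_seq.
rewrite (eq_bigr (fun=> (-1) ^+ #|ascents s| * 'X^(n - (#|ascents s|).*2))).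
  rewrite -big_seq big_const_seq count_predT iter_addr_0 scaler_nat.
  rewrite -mul_polyC; congr (_ * _ *+ _).
  by rewrite rmorphXn rmorphN1.
move=> D DL; rewrite perm_prod_matching // odd_involution //.
by rewrite signr_odd.
Qed.

End AverageCharPoly.

(** * Reality and symmetry of the spectrum *)

Section Spectrum.
Variable R : realType.
Local Notation C := R[i].
Local Notation normc := ComplexField.Normc.normc.

Lemma normc_real (x : R) : normc x%:C = `|x|.
Proof. by rewrite /= expr0n addr0 sqrtr_sqr. Qed.

(** If [z] is not real, then [z%:M - M] or its opposite is dissipative, hence invertible. *)
Lemma hermitian_eigenvalue_real n (M : 'M[C]_n) z :
  hermitian M -> root (char_poly M) z -> complex.Im z = 0.
Proof.
move=> hM; rewrite /root horner_char_poly => /eqP det0.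
have [Im_lt0|Im_gt0|//] := ltgtP (complex.Im z) 0; last first.
  have /dissipative_det/eqP[] := dissipativeD_hermitian
    (dissipative_scalar Im_gt0) (hermitianN hM).
  exact: det0.
have Im_gt0 : 0 < complex.Im (- z) by rewrite raddfN oppr_gt0.
have /dissipative_det/eqP[] := dissipativeD_hermitian (dissipative_scalar Im_gt0) hM.
rewrite (_ : _ + M = - (z%:M - M)); last by rewrite opprB raddfN addrC.
by rewrite -scaleN1r detZ det0 mulr0.
Qed.

(** Negating the coordinates of an eigenvector on one side of the bipartition negates its
    eigenvalue. *)
Lemma eigenvalueN_bipartite (V : finType) (G : sgraph V) (M : 'M[C]_#|V|) z :
    bipartite G -> (forall i j, ~~ G (enum_val i) (enum_val j) -> M i j = 0) ->
  eigenvalue M z -> eigenvalue M (- z).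
Proof.
move=> [A GA] M0 /eigenvalueP[v vM v_n0].
pose c (i : 'I_#|V|) : C := (-1) ^+ (enum_val i \in A).
apply/eigenvalueP; exists (\row_i (c i * v 0 i)); last first.
  have [i vi] := rV0Pn _ v_n0; apply/rV0Pn; exists i.
  by rewrite mxE mulf_neq0 // signr_eq0.
apply/rowP => j; move/rowP/(_ j): vM; rewrite !mxE => vMj.
transitivity (- c j * \sum_k v 0 k * M k j); last by rewrite vMj; ring.
rewrite mulr_sumr; apply: eq_bigr => k _; rewrite !mxE.
have [/GA kj|/M0 ->] := boolP (G (enum_val k) (enum_val j)); last by rewrite !mulr0.
suff -> : c k = - c j by ring.
rewrite /c; move: kj; case: (_ \in A); case: (_ \in A) => // _;
  by rewrite ?expr0 ?expr1 ?opprK.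
Qed.

End Spectrum.

Theorem corollary2p9 (R : realType) (V : finType) (G T : sgraph V)
    (hconn : connected G) (hbip : bipartite G) (hT : spanning_tree G T) :
  exists sigma : V -> V -> int,
    partial_orientation G T sigma /\
    spectral_radius (hermitian_adj R G T sigma)
      <= root_radius (matching_poly G R[i]).
Proof.
case: hT => subTG _ acyclicT; case: hconn => V_gt0 _.
set mu := matching_poly G R[i]; set t := root_radius mu.
pose L := chords G T; pose H0 := tree_mx R T.
have dL : all (fun e : 'I_#|V| * 'I_#|V| => e.1 != e.2) L.
  by apply: sub_all (chords_lt G T) => e; apply: contraTneq => ->; rewrite ltnn.
have hH0 : hermitian H0.
  by apply/matrixP => i j; rewrite !mxE rmorph_nat adj_sym.
have muE : map_poly (real_complex R) (charsum L H0) = (size (signings R L))%:R *: mu.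
  by rewrite toC_charsum // (sum_char_poly _ acyclicT subTG).
have N_n0 : (size (signings R L))%:R != 0 :> R[i].
  by rewrite pnatr_eq0 -lt0n size_signings.
have [s_sum lc_sum] := charsum_size L H0.
have s_mu : size mu = #|V|.+1.
  by rewrite -(size_scale _ N_n0) -muE size_map_poly s_sum.
have [_ root_le] : (exists2 z, root mu z & t = ComplexField.Normc.normc z) /\
  (forall z, root mu z -> ComplexField.Normc.normc z <= t).
  by apply: root_radiusP; rewrite s_mu ltnS.
(* A nonpositive value above [t] would yield a real root above [t], which is also a root of [mu]. *)
have sum_pos : pos_above t (charsum L H0).
  move=> x tx; rewrite ltNge; apply/negP => sum_le0.
  have [|y [xy y0 _]] := pos_above_root _ sum_le0.
    by rewrite lc_sum ltr0n size_signings.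
  have /root_le : root mu y%:C.
    by rewrite -(rootZ _ _ N_n0) -muE fmorph_root; apply/rootP.
  rewrite normc_real => /(le_trans (ler_norm _)) yt.
  by have := lt_le_trans tx (le_trans xy yt); rewrite ltxx.
have [D DL D_pos] := exists_signing dL hH0 sum_pos.
have [S SP] := signed_entries DL.
pose sigma u v := S (enum_rank u) (enum_rank v).
have adjE : hermitian_adj R G T sigma = H0 + D.
  apply/matrixP => i j; rewrite mxE /sigma !enum_valK.
  have [-> _ _ Sn0] := SP i j; case: ifP => // Tij; case: ifP Sn0 => // Gij.
  by move=> /negbT; rewrite negbK => /eqP ->; rewrite mulr0z mulr0.
exists sigma; split.
  move=> u v nT; have [_ Santi S01 Sn0] := SP (enum_rank u) (enum_rank v).
  by split=> //; rewrite /sigma Sn0 !enum_rankK nT andbT.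
have hM : hermitian (H0 + D) by apply/hermitianD/(hermitian_signings DL).
rewrite adjE spectral_radiusE.
have [[z z_root ->] _] : (exists2 z, root (char_poly (H0 + D)) z &
    root_radius (char_poly (H0 + D)) = ComplexField.Normc.normc z) /\
  (forall z, root (char_poly (H0 + D)) z ->
    ComplexField.Normc.normc z <= root_radius (char_poly (H0 + D))).
  by apply: root_radiusP; rewrite size_char_poly ltnS.
have root_le_t x : root (char_poly (H0 + D)) x%:C -> x <= t.
  rewrite -(hermitian_char_poly hM) fmorph_root => /rootP x0.
  by rewrite leNgt; apply/negP => /D_pos; rewrite x0 ltxx.
have zE : z = (complex.Re z)%:C.
  by case: z z_root => a b /(hermitian_eigenvalue_real hM) /= ->.
rewrite zE in z_root *; rewrite normc_real ler_norml.
(* The lower bound on the real eigenvalue [z] is the upper bound applied to the eigenvalue [- z]. *)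
rewrite (root_le_t _ z_root) andbT lerNl; apply: root_le_t; rewrite rmorphN.
rewrite -eigenvalue_root_char; apply: (eigenvalueN_bipartite hbip) => [i j nG|].
  exact: signed_entry0 DL nG.
by rewrite eigenvalue_root_char.
Qed.
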